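(* Let $N_1,N_2,\dots$ be positive integers with $N_k\mid N_{k+1}$ for all $k$, and let $d_1,d_2,\dots$ be positive integers. Suppose $f_1,f_2,\dots$ are trigonometric polynomials on $\mathbb{T}$ such that $\deg f_k\le d_k$ and $f_k$ is $\frac{2\pi}{N_k}$-periodic. Then \[(1-C\theta)\|(f_k)\|_{\mathrm{ind}}\le\|(f_k)\|_{L^1(\ell^2)}\le(1+C\theta)\|(f_k)\|_{\mathrm{ind}},\] where $\theta=\sup_k\frac{d_k}{N_{k+1}}$ and $C$ is a numerical constant.
   Context: $\mathbb{T}=\mathbb{R}/2\pi\mathbb{Z}$ with normalized Lebesgue measure $\mu$. $\|(g_k)\|_{L^1(\ell^2)}=\int_{\mathbb{T}}(\sum_k|g_k|^2)^{1/2}d\mu$ and $\|(g_k)\|_{\mathrm{ind}}=\int_{\mathbb{T}^\infty}(\sum_k|g_k(t_k)|^2)^{1/2}d(\mu\otimes\mu\otimes\cdots)(t_1,t_2,\dots)$. *)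

(* Defs.v *)
From HB Require Import structures.
From mathcomp Require Import all_boot all_order all_algebra.
From mathcomp Require Import complex.
From mathcomp Require Import all_classical all_reals all_analysis.
Set Implicit Arguments. Unset Strict Implicit. Unset Printing Implicit Defensive.
Import Order.TTheory GRing.Theory Num.Theory.
Local Open Scope classical_set_scope.
Local Open Scope ring_scope.

(* The torus T = R / 2piZ is represented by 2pi-periodic functions on R;
   the normalized Haar measure on T is (2pi)^-1 * Lebesgue on [0, 2pi]. *)

(* T^infty, represented as sequences of reals (coordinates in R, read mod 2pi) *)
Definition seqR (R : realType) := nat -> R.
HB.instance Definition _ (R : realType) := gen_eqMixin (seqR R).
HB.instance Definition _ (R : realType) := gen_choiceMixin (seqR R).
HB.instance Definition _ (R : realType) := isPointed.Build (seqR R) (fun _ => 0%R).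

Section Defs.
Variable R : realType.

Definition expi (x : R) : R[i] := (cos x +i* sin x)%C.

Definition sqmod (z : R[i]) : R := complex.Re z ^+ 2 + complex.Im z ^+ 2.

Definition trig_poly_deg_le (d : nat) (f : R -> R[i]) : Prop :=
  exists c : int -> R[i], forall t : R,
    f t = \sum_(j < (2 * d).+1) c (j%:Z - d%:Z) * expi ((j%:Z - d%:Z)%:~R * t).

Definition sqrte (x : \bar R) : \bar R :=
  match x with
  | r%:E => (Num.sqrt r)%:E
  | +oo%E => +oo%E
  | -oo%E => 0%E
  end.

Definition I2pi : set R := `[0, 2 * pi]%classic.

Definition muT (A : set R) : \bar R :=
  (((2 * pi)^-1)%:E * lebesgue_measure (A `&` I2pi))%E.

Definition l2_at (g : nat -> R[i]) : \bar R :=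
  sqrte (\sum_(0 <= k <oo) (sqmod (g k))%:E)%E.

Definition L1l2_norm (g : nat -> R -> R[i]) : \bar R :=
  (((2 * pi)^-1)%:E *
     \int[lebesgue_measure]_(t in I2pi) l2_at (fun k => g k t))%E.

Definition cylinders : set (set (seqR R)) :=
  [set B | exists k (A : set R), measurable A /\ B = (fun t => t k) @^-1` A].

Definition Tinf := g_sigma_algebraType cylinders.

(* P is the infinite product measure mu (x) mu (x) ... on T^infty:
   its value on finite-dimensional rectangles is the product of the mu's.
   (Such a probability exists and is unique by Kolmogorov / pi-lambda.) *)
Definition is_infinite_product (P : probability Tinf R) : Prop :=
  forall (n : nat) (A : nat -> set R), (forall k, measurable (A k)) ->
    P [set t : Tinf | forall k, (k < n)%N -> A k (t k)] =
    (\prod_(k < n) muT (A k))%E.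

Definition ind_norm (P : probability Tinf R) (g : nat -> R -> R[i]) : \bar R :=
  (\int[P]_(t in [set: Tinf]) l2_at (fun k => g k (t k)))%E.

End Defs.

(* Main.v *)
From HB Require Import structures.
Require Import Defs.
From mathcomp Require Import all_boot all_order all_algebra.
From mathcomp Require Import complex.
From mathcomp Require Import all_classical all_reals all_analysis.
From mathcomp Require Import measurable_realfun ring lra zify.
Set Implicit Arguments. Unset Strict Implicit. Unset Printing Implicit Defensive.
Import Order.TTheory GRing.Theory Num.Theory.
Import numFieldNormedType.Exports.
Local Open Scope classical_set_scope.
Local Open Scope ring_scope.

(* Decouple one function at a time.  Put X_k = |f_k|^2 and, for fixed later
   variables, y = sum_{k > i} X_k(t_k), A = sum_{k < i} X_k and
     h_b(t) = sqrt (A(t) + b + y) - sqrt (A(t) + y),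
   which lies between 0 and sqrt (b + y) - sqrt y.  Since h_b is an injective
   function of the trigonometric polynomial A, which takes each value at most
   4 max_{k < i} d_k <= 4 theta N_i times per period, its total variation is at
   most 4 theta N_i (sqrt (b + y) - sqrt y).  Hence its mean over N_i equispaced
   points differs from its integral by at most 4 theta (sqrt (b + y) - sqrt y).
   As X_i is 2pi/N_i-periodic, taking b = X_i shows that replacing X_i(t_i) by
   X_i(t) changes the norm by at most
     4 theta E (sqrt (sum_{k >= i} X_k(t_k)) - sqrt (sum_{k > i} X_k(t_k))),
   and these errors telescope to 4 theta times the independent norm. *)

(** * Squared moduli of trigonometric polynomials: level counts, continuity, boundedness *)

Section TrigonometricPolynomials.
Variable R : realType.
Implicit Types (t x y : R) (z : R[i]) (d : nat) (f : R -> R[i]).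

Lemma expiD x y : expi (x + y) = expi x * expi y.
Proof. by rewrite /expi cosD sinD; simpc; congr (_ +i* _)%C; ring. Qed.

Lemma expi0 : expi (0 : R) = 1.
Proof. by rewrite /expi cos0 sin0. Qed.

Lemma expi_natr (n : nat) x : expi (n%:R * x) = expi x ^+ n.
Proof.
elim: n => [|n IHn]; first by rewrite mul0r expi0 expr0.
by rewrite -addn1 natrD mulrDl mul1r expiD IHn exprD expr1.
Qed.

Lemma expi_neq0 x : expi x != 0.
Proof.
apply/eqP => e0; have := expiD x (- x).
by rewrite subrr expi0 e0 mul0r => /eqP; rewrite oner_eq0.
Qed.

Lemma conjc_expi x : ((expi x)^*)%C = expi (- x).
Proof. by rewrite /expi cosN sinN. Qed.

(** Equal values force [cos (y - x) = 1], hence [sin ((y - x) / 2) = 0]; but half the difference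
    lies in [0, pi), where the sine vanishes only at 0. *)
Lemma expi_inj t x y : t <= x < t + 2 * pi -> t <= y < t + 2 * pi ->
  expi x = expi y -> x = y.
Proof.
wlog xy : x y / x <= y.
  move=> H hx hy exy; have [/H|/ltW/H] := leP x y; first exact.
  by move=> /(_ hy hx (esym exy)).
move=> /andP[tx _] /andP[_ yt] [ec es].
have c1 : cos (y - x) = 1 by rewrite cosB ec es -!expr2 cos2Dsin2.
have : cos (((y - x) / 2) *+ 2) = 1 by rewrite -mulr_natr divfK// c1.
rewrite cos_mulr2n cos2sin2 => h.
have s0 : sin ((y - x) / 2) = 0 by apply/eqP; rewrite -sqrf_eq0; apply/eqP; lra.
apply/eqP; rewrite eq_le xy /= leNgt; apply/negP => xlty.
suff : 0 < sin ((y - x) / 2) by rewrite s0 ltxx.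
by apply: sin_gt0_pi; apply/andP; split; lra.
Qed.

Lemma sqmod_mulc z : ((sqmod z)%:C)%C = z * (z^*)%C.
Proof. by case: z => a b; rewrite /sqmod /=; simpc; congr (_ +i* _)%C; ring. Qed.

Lemma sqmod_ge0 z : 0 <= sqmod z.
Proof. by rewrite addr_ge0 ?sqr_ge0. Qed.

Lemma size_sum_XnZ (n : nat) (c : nat -> R[i]) (e : nat -> nat) m :
  (forall j, (j < n)%N -> (e j <= m)%N) ->
  (size (\sum_(j < n) c j *: 'X^(e j))%R <= m.+1)%N.
Proof.
move=> em; apply: (leq_trans (size_sum _ _ _)); apply/bigmax_leqP => j _.
by apply: (leq_trans (size_scale_leq _ _)); rewrite size_polyXn ltnS em.
Qed.

(** Multiplication by [expi t ^+ d] turns both [f] and its conjugate into polynomials of degree at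
    most 2d in [expi t]. A common [D] in place of [d] lets functions of different degrees be
    added. *)
Lemma sqmod_trig_poly d f D : trig_poly_deg_le d f -> (d <= D)%N ->
  exists2 p : {poly R[i]}, (size p <= (4 * D).+1)%N &
    forall t, ((sqmod (f t))%:C)%C * expi t ^+ (2 * D) = p.[expi t].
Proof.
move=> [c fE] dD.
pose c' (j : nat) := c (j%:Z - d%:Z).
pose q := \sum_(j < (2 * d).+1) c' j *: 'X^j.
(* Conjugation negates the frequency j - d, so the shift by d gives the reversed exponent 2d - j. *)
pose r := \sum_(j < (2 * d).+1) ((c' j)^*)%C *: 'X^(2 * d - j).
have qE t : f t * expi t ^+ d = q.[expi t].
  rewrite fE mulr_suml horner_sum; apply: eq_bigr => j _.
  rewrite hornerZ hornerXn -mulrA -!expi_natr -expiD; congr (_ * expi _).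
  by rewrite -mulrDl rmorphB /= subrK.
have rE t : ((f t)^*)%C * expi t ^+ d = r.[expi t].
  have conjM (a b : R[i]) : ((a * b)^*)%C = (a^*)%C * (b^*)%C by exact: rmorphM.
  have conjD : {morph (@conjc R) : a b / a + b} by exact: rmorphD.
  rewrite fE (big_morph _ conjD (rmorph0 _)) mulr_suml horner_sum; apply: eq_bigr => j _.
  rewrite hornerZ hornerXn conjM conjc_expi -mulrA -!expi_natr -expiD.
  congr (_ * expi _); rewrite -mulNr -mulrDl; congr (_ * _).
  rewrite natrB -1?ltnS// rmorphB /= -!pmulrn natrM; ring.
exists (q * r * 'X^(2 * (D - d))) => [|t].
  have sq : (size q <= (2 * d).+1)%N.
    by apply: (@size_sum_XnZ _ c' id) => j; rewrite ltnS.
  have sr : (size r <= (2 * d).+1)%N.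
    apply: (@size_sum_XnZ _ (fun j => ((c' j)^*)%C) (fun j => (2 * d - j)%N)).
    by move=> j _; rewrite leq_subr.
  have := size_polyMleq q r; have := size_polyMleq (q * r) 'X^(2 * (D - d)).
  rewrite size_polyXn; move: sq sr dD.
  move: (size q) (size r) (size (q * r)) (size (q * r * _)) => ? ? ? ?; lia.
rewrite !hornerM hornerXn -qE -rE sqmod_mulc.
have -> : (2 * D = d + d + 2 * (D - d))%N by lia.
by rewrite !exprD; ring.
Qed.

(* Unless [A] is constant, it takes each value at most [K] times per period. *)
Definition level_count_le (K : nat) (A : R -> R) := forall v t (s : seq R),
  uniq s -> (forall x, x \in s -> t <= x < t + 2 * pi /\ A x = v) ->
  (K < size s)%N -> forall x, A x = v.

(** After multiplication by [expi t ^+ (2 * D)], the sum minus [v] is a polynomial of degree at most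
    4D in [expi t]. More than 4D solutions in one period are too many roots, so the polynomial is
    zero and the sum equals [v] everywhere. *)
Lemma level_count_sum_sqmod (f : nat -> R -> R[i]) (d : nat -> nat) D n :
  (forall k, (k < n)%N -> trig_poly_deg_le (d k) (f k)) ->
  (forall k, (k < n)%N -> (d k <= D)%N) ->
  level_count_le (4 * D) (fun t => \sum_(k < n) sqmod (f k t)).
Proof.
move=> fd dD v t s us sv sK x.
have [p sp pE] : exists2 p : {poly R[i]}, (size p <= (4 * D).+1)%N &
    forall t, ((\sum_(k < n) sqmod (f k t))%:C)%C * expi t ^+ (2 * D)
      = p.[expi t].
  elim: n fd dD {sv} => [_ _|n IHn fd dD].
    by exists 0 => [|u]; rewrite ?size_poly0// big_ord0 horner0 mul0r.
  case: IHn => [k kn|k kn|p sp pE]; [exact/fd/ltnW|exact/dD/ltnW|].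
  have [q sq qE] := sqmod_trig_poly (fd n (ltnSn n)) (dD n (ltnSn n)).
  exists (p + q) => [|u].
    by apply: (leq_trans (size_polyD _ _)); rewrite geq_max sp sq.
  by rewrite big_ord_recr rmorphD mulrDl pE qE hornerD.
pose q := p - ((v%:C)%C)%:P * 'X^(2 * D).
have qE u : q.[expi u]
    = ((\sum_(k < n) sqmod (f k u) - v)%:C)%C * expi u ^+ (2 * D).
  by rewrite hornerD hornerN hornerM hornerC hornerXn -pE rmorphB mulrBl.
have sq : (size q <= (4 * D).+1)%N.
  apply: (leq_trans (size_polyD _ _)); rewrite geq_max sp size_polyN.
  by apply: (leq_trans (size_polyMleq _ _)); rewrite size_polyC size_polyXn; lia.
have q0 : q = 0.
  apply/eqP; apply/negPn/negP => q0.
  have : (size (map (@expi R) s) < size q)%N.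
    apply: max_poly_roots => //.
      apply/allP => _ /mapP[u us' ->]; rewrite rootE qE.
      by have [_ ->] := sv u us'; rewrite subrr mul0r.
    rewrite map_inj_in_uniq// => u w us' ws.
    by apply: expi_inj; [case: (sv u us') => + _; apply|case: (sv w ws)].
  rewrite size_map; lia.
have /eqP := qE x; rewrite q0 horner0 eq_sym mulf_eq0 expf_eq0.
rewrite (negbTE (expi_neq0 x)) andbF orbF => /eqP[] /eqP.
by rewrite subr_eq0 => /eqP.
Qed.

Lemma Re_trig_poly d f : trig_poly_deg_le d f -> exists a b : nat -> R,
  forall t, complex.Re (f t) = \sum_(j < (2 * d).+1)
    (a j * cos ((j%:Z - d%:Z)%:~R * t) - b j * sin ((j%:Z - d%:Z)%:~R * t)).
Proof.
move=> [c fE]; exists (fun j => complex.Re (c (j%:Z - d%:Z))).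
exists (fun j => complex.Im (c (j%:Z - d%:Z))) => t.
rewrite fE raddf_sum; apply: eq_bigr => j _.
by case: (c _) => a b; rewrite /expi; simpc.
Qed.

Lemma Im_trig_poly d f : trig_poly_deg_le d f -> exists a b : nat -> R,
  forall t, complex.Im (f t) = \sum_(j < (2 * d).+1)
    (a j * cos ((j%:Z - d%:Z)%:~R * t) - b j * sin ((j%:Z - d%:Z)%:~R * t)).
Proof.
move=> [c fE]; exists (fun j => complex.Im (c (j%:Z - d%:Z))).
exists (fun j => - complex.Re (c (j%:Z - d%:Z))) => t.
rewrite fE raddf_sum; apply: eq_bigr => j _.
by case: (c _) => a b; rewrite /expi /=; simpc; rewrite addrC.
Qed.

Lemma continuous_cos_sin_sum n (a b : nat -> R) (l : nat -> R) :
  continuous (fun t => \sum_(j < n) (a j * cos (l j * t) - b j * sin (l j * t))).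
Proof.
move=> t; apply: cvg_big => [|j _]; first exact: add_continuous.
have cl : l j * x @[x --> t] --> l j * t by apply: cvgMr; exact: cvg_id.
apply: cvgB; apply: cvgMr.
  exact: (cvg_comp _ _ cl (@continuous_cos R _)).
exact: (cvg_comp _ _ cl (@continuous_sin R _)).
Qed.

Lemma bounded_cos_sin_sum n (a b : nat -> R) (l : nat -> R) :
  exists B, forall t,
    `|\sum_(j < n) (a j * cos (l j * t) - b j * sin (l j * t))| <= B.
Proof.
exists (\sum_(j < n) (`|a j| + `|b j|)) => t.
apply: (le_trans (ler_norm_sum _ _ _)); apply: ler_sum => j _.
apply: (le_trans (ler_normB _ _)); rewrite !normrM.
by apply: lerD; rewrite ler_piMr// ?cos_max ?sin_max.
Qed.

Lemma continuous_sqmod_trig_poly d f : trig_poly_deg_le d f ->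
  continuous (fun t => sqmod (f t)).
Proof.
move=> fd; have [a [b fR]] := Re_trig_poly fd; have [a' [b' fI]] := Im_trig_poly fd.
rewrite /sqmod; under eq_fun do rewrite fR fI !expr2.
move=> t; have h := @continuous_cos_sin_sum (2 * d).+1.
by apply: cvgD; apply: cvgM; exact: (h _ _ (fun j => (j%:Z - d%:Z)%:~R)).
Qed.

(** These bounds make the integrals of finite sums finite, so that they can be cancelled in
    extended-real inequalities. *)
Lemma bounded_sqmod_trig_poly d f : trig_poly_deg_le d f ->
  exists B, forall t, sqmod (f t) <= B.
Proof.
move=> fd; have [a [b fR]] := Re_trig_poly fd; have [a' [b' fI]] := Im_trig_poly fd.
have [B hB] := bounded_cos_sin_sum (2 * d).+1 a b (fun j => (j%:Z - d%:Z)%:~R).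
have [B' hB'] := bounded_cos_sin_sum (2 * d).+1 a' b' (fun j => (j%:Z - d%:Z)%:~R).
exists (B ^+ 2 + B' ^+ 2) => t; rewrite /sqmod fR fI.
by apply: lerD; rewrite -[leLHS]real_normK ?num_real//;
  rewrite lerXn2r// nnegrE ?(le_trans _ (hB 0))// (le_trans _ (hB' 0)).
Qed.

End TrigonometricPolynomials.

(** * Variation argument for sums over equispaced points *)

Section Discrepancy.
Variable R : realType.

(** The total length is the integral over [0, M] of the number of intervals covering a point, and
    that number is at most [p]. *)
Lemma sum_itv_length_le (n p : nat) (a b : 'I_n -> R) (M : R) :
  0 <= M -> (forall i, 0 <= a i <= b i) -> (forall i, b i <= M) ->
  (forall v, (#|[set i | (a i < v < b i)%R]%SET| <= p)%N) ->
  \sum_i (b i - a i) <= p%:R * M.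
Proof.
move=> M0 ab bM cp.
pose E i : set (measurableTypeR R) := `]a i, b i[%classic.
have mE i : measurable (E i) by exact: measurable_itv.
have len i : (\int[lebesgue_measure]_(x in `[0%R, M]) (\1_(E i) x)%:E
    = (b i - a i)%:E)%E.
  rewrite integral_indic// setIidl.
    rewrite /E/= lebesgue_measure_itv/= lte_fin -EFinD; case: ltP => // bai.
    congr EFin; apply/esym/eqP; rewrite subr_eq0 eq_le bai.
    by have /andP[_ ->] := ab i.
  move=> x; rewrite /E/= !in_itv/= => /andP[ax xb]; have /andP[a0 _] := ab i.
  by rewrite (le_trans a0 (ltW ax)) (le_trans (ltW xb) (bM i)).
rewrite -lee_fin -sumEFin; under eq_bigr do rewrite -len.
rewrite -ge0_integral_sum//; last first.
- by move=> i; exact/measurable_EFinP/measurable_indic.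
apply: (@le_trans _ _ (\int[lebesgue_measure]_(x in `[0%R, M]) (p%:R)%:E)%E).
  apply: ge0_le_integral => //.
  - by move=> x _; apply: sume_ge0.
  - apply: emeasurable_sum => i; exact/measurable_EFinP/measurable_indic.
  - move=> x _; rewrite sumEFin lee_fin.
    under eq_bigr do rewrite indicE.
    rewrite -natr_sum ler_nat (leq_trans _ (cp x))//.
    rewrite -sum1_card big_mkcond/= [leqRHS]big_mkcond/=; apply: leq_sum => i _.
    by rewrite !inE /E/= mem_setE in_itv/=; case: ifP.
rewrite integral_cst//= lebesgue_measure_itv/= lte_fin.
by case: ltP => M0'; rewrite ?oppr0 ?adde0 ?mule0 -?EFinM lee_fin ?mulr_ge0.
Qed.

Variables (h : R -> R) (K N : nat) (M : R).
Hypotheses (h_cont : continuous h) (hD2pi : forall x, h (x + 2 * pi) = h x).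
Hypotheses (h_ge0 : forall x, 0 <= h x) (h_le : forall x, h x <= M).
Hypotheses (h_level : level_count_le K h) (N_gt0 : (0 < N)%N).

Let delta : R := 2 * pi / N%:R.
Let S x := \sum_(m < N) h (x + m%:R * delta).

Let N_neq0 : N%:R != 0 :> R. Proof. by rewrite pnatr_eq0 -lt0n. Qed.
Let delta_gt0 : 0 < delta.
Proof. by rewrite divr_gt0 ?mulr_gt0 ?pi_gt0 ?ltr0n. Qed.

(** Shifting by [delta] moves each node to the next one, and the last node to the first plus a full
    period. *)
Let S_shift x : S (x + delta) = S x.
Proof.
rewrite /S; case: N N_gt0 N_neq0 @delta => // n _ nN0 delta'.
rewrite [in LHS]big_ord_recr [in RHS]big_ord_recl /= addrC; congr (_ + _).
  rewrite mul0r addr0 -[RHS]hD2pi; congr h.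
  rewrite -addrA; congr (_ + _); rewrite /delta' -natr1; field.
  by rewrite addrC natr1.
apply: eq_bigr => m _; congr h; rewrite /bump/= add1n -natr1 mulrDl mul1r; ring.
Qed.

Let S_shiftn (q : nat) x : S (x + q%:R * delta) = S x.
Proof.
elim: q => [|q IHq]; first by rewrite mul0r addr0.
by rewrite -natr1 mulrDl mul1r addrA S_shift.
Qed.

(** The increase of [h] from [x + m%:R * delta] to [y + m%:R * delta] is at most the length of ]a m,
    b m[. A value [v] in that interval is attained between the two points by the intermediate value
    theorem. These cells are disjoint and lie in one period, so at most [K] intervals contain [v]
    unless [h] is constant. *)
Let S_gap x y : x <= y < x + delta -> S y <= S x + K%:R * M.
Proof.
move=> /andP[xy yx].
have M0 : 0 <= M := le_trans (h_ge0 0) (h_le 0).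
(* The level count says nothing about constant functions, for which the two sums agree. *)
have [hc|hnc] := pselect (forall u w, h u = h w).
  rewrite /S; under eq_bigr do rewrite (hc _ 0).
  by under [in leRHS]eq_bigr do rewrite (hc _ 0); rewrite lerDl mulr_ge0.
rewrite -lerBlDl /S -sumrB.
pose a (m : 'I_N) := h (x + m%:R * delta).
(* The maximum makes the interval empty when [h] does not increase from one end of the cell to the
   other. *)
pose b (m : 'I_N) := Num.max (a m) (h (y + m%:R * delta)).
apply: (@le_trans _ _ (\sum_m (b m - a m))).
  by apply: ler_sum => m _; rewrite lerD2r le_max lexx orbT.
apply: sum_itv_length_le => // [m|m|v].
- by rewrite h_ge0 le_max lexx.
- by rewrite ge_max !h_le.
rewrite leqNgt; apply/negP => Kv; apply: hnc.
suff H : forall w, h w = v by move=> u w; rewrite !H.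
have /choice[z zP] : forall m : 'I_N, exists z, a m < v < b m ->
    x + m%:R * delta <= z <= y + m%:R * delta /\ h z = v.
  move=> m; have [/andP[av vb]|_] := boolP (a m < v < b m); last by exists 0.
  have vy : v < h (y + m%:R * delta).
    by move: vb; rewrite lt_max ltNge (ltW av).
  have [|||z + hz] := @IVT R h (x + m%:R * delta) (y + m%:R * delta) v.
  - by rewrite lerD2r.
  - by apply: continuous_subspaceT.
  - rewrite ge_min le_max -/(a m) (ltW av) (ltW vy) orbT//.
  by rewrite in_itv/= => hz'; exists z => _.
(* Since y < x + delta, each cell sits in a half-open interval of length [delta], so distinct
   indices give distinct points [z m]. *)
have cell m : a m < v < b m ->
    x + m%:R * delta <= z m /\ z m < x + m.+1%:R * delta.
  move=> /zP[/andP[z1 z2] _]; split => //; apply: (le_lt_trans z2).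
  by rewrite -natr1 mulrDl mul1r [m%:R * _ + _]addrC addrA ltrD2r.
apply: (h_level (t := x) (s := [seq z m | m <- enum [set m | a m < v < b m]%SET])).
- rewrite map_inj_in_uniq ?enum_uniq// => m m'; rewrite !mem_enum !inE.
  move=> /cell[z1 z2] /cell[z3 z4] zz; apply/val_inj/eqP => /=.
  rewrite eqn_leq; apply/andP; split; rewrite leqNgt; apply/negP => mm.
  + have : m'.+1%:R * delta <= m%:R * delta by rewrite ler_pM2r// ler_nat.
    by rewrite zz in z1; lra.
  + have : m.+1%:R * delta <= m'%:R * delta by rewrite ler_pM2r// ler_nat.
    by rewrite zz in z2; lra.
- move=> w /mapP[m]; rewrite mem_enum inE => mv ->.
  have [z1 z2] := cell m mv; have [_ ->] := zP m mv; split => //.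
  have m0 : 0 <= m%:R * delta by rewrite mulr_ge0// ltW.
  have : m.+1%:R * delta <= N%:R * delta.
    by rewrite ler_pM2r// ler_nat ltn_ord.
  have -> : N%:R * delta = 2 * pi by rewrite mulrC /delta divfK.
  by move=> h1; apply/andP; split; lra.
- by rewrite size_map -cardE.
Qed.

(** Both base points may be moved by whole steps, until [t] lies less than one step to the left of
    [s] and [S_gap] applies. *)
Lemma equispaced_sum_gap s t :
  \sum_(m < N) h (s + m%:R * (2 * pi / N%:R))
    <= \sum_(m < N) h (t + m%:R * (2 * pi / N%:R)) + K%:R * M.
Proof.
rewrite -/delta -/(S s) -/(S t).
(* This many steps carry [s] to the right of [t]. *)
pose k := (Num.truncn (`|t - s| / delta)).+1.
have ts : t <= s + k%:R * delta.
  rewrite -lerBlDl (le_trans (ler_norm _))// -ler_pdivrMr//.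
  by rewrite ltW// /k truncnS_gt.
rewrite -(S_shiftn k s); move: (s + _) ts => {k}s ts.
(* This many steps bring [t] to within [delta] of the new [s], from the left. *)
pose q := Num.truncn ((s - t) / delta).
have := @truncn_itv R ((s - t) / delta).
rewrite -/q => /(_ _)/andP[|q1 q2].
  by rewrite divr_ge0 ?(ltW delta_gt0)// subr_ge0.
rewrite -(S_shiftn q t); apply: S_gap; move: q1 q2.
rewrite ler_pdivlMr// ltr_pdivrMr// -natr1 mulrDl mul1r => q1 q2.
by apply/andP; split; lra.
Qed.

End Discrepancy.

(** * Increments of the square root and their equispaced means *)

Section SqrtGap.
Variable R : realType.

(** Injectivity on the values of [A] makes every nonempty level set of [psi \o A] a level set of
    [A]. *)
Lemma level_count_comp (K : nat) (A : R -> R) (psi : R -> R) :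
  (forall x y, psi (A x) = psi (A y) -> A x = A y) ->
  level_count_le K A -> level_count_le K (psi \o A).
Proof.
move=> psi_inj AK v t [//|z s] us sv sK x.
have AE : forall w, A w = A z.
  apply: (AK _ t _ us _ sK) => w ws; have [tw pw] := sv w ws; split => //.
  by apply: psi_inj; case: (sv z (mem_head _ _)) => _ /= ->.
by rewrite /= AE; case: (sv z (mem_head _ _)).
Qed.

(** Concavity: adding [b] raises the square root no more at the larger base a + y than at y. *)
Lemma sqrt_increment_le (a b y : R) : 0 <= a -> 0 <= b -> 0 <= y ->
  Num.sqrt (a + b + y) - Num.sqrt (a + y) <= Num.sqrt (b + y) - Num.sqrt y.
Proof.
move=> a0 b0 y0.
have e1 := @sqr_sqrtr R (a + b + y) ltac:(lra).
have e2 := @sqr_sqrtr R (a + y) ltac:(lra).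
have e3 := @sqr_sqrtr R (b + y) ltac:(lra).
have e4 := @sqr_sqrtr R y ltac:(lra).
have l1 : Num.sqrt (b + y) <= Num.sqrt (a + b + y) by rewrite ler_wsqrtr//; lra.
have l2 : Num.sqrt y <= Num.sqrt (a + y) by rewrite ler_wsqrtr//; lra.
have l3 : Num.sqrt y <= Num.sqrt (b + y) by rewrite ler_wsqrtr//; lra.
have := sqrtr_ge0 y; move: (Num.sqrt (a + b + y)) (Num.sqrt (a + y))
  (Num.sqrt (b + y)) (Num.sqrt y)
  e1 e2 e3 e4 l1 l2 l3 => p q r s e1 e2 e3 e4 l1 l2 l3 s0.
by rewrite leNgt; apply/negP => lt; nra.
Qed.

(** On each side the squares of the two roots differ by [b], which is positive; equal differences of
    roots therefore have equal sums of roots, and the roots themselves agree. *)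
Lemma sqrt_increment_inj (a a' b y : R) : 0 <= a -> 0 <= a' -> 0 < b -> 0 <= y ->
  Num.sqrt (a + b + y) - Num.sqrt (a + y)
    = Num.sqrt (a' + b + y) - Num.sqrt (a' + y) -> a = a'.
Proof.
move=> a0 a'0 b0 y0.
have e1 := @sqr_sqrtr R (a + b + y) ltac:(lra).
have e2 := @sqr_sqrtr R (a + y) ltac:(lra).
have e3 := @sqr_sqrtr R (a' + b + y) ltac:(lra).
have e4 := @sqr_sqrtr R (a' + y) ltac:(lra).
have l1 : Num.sqrt (a + y) < Num.sqrt (a + b + y) by rewrite ltr_sqrt//; lra.
have [p0 q0 s0] := And3 (sqrtr_ge0 (a + b + y)) (sqrtr_ge0 (a + y)) (sqrtr_ge0 (a' + y)).
move: (Num.sqrt (a + b + y)) (Num.sqrt (a + y)) (Num.sqrt (a' + b + y))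
  (Num.sqrt (a' + y)) e1 e2 e3 e4 l1 p0 q0 s0 => p q r s e1 e2 e3 e4 l1 p0 q0 s0 e.
have : (p - q) * ((p + q) - (r + s)) = 0 :> R.
  by rewrite mulrBr [X in _ - X * _]e; nra.
move=> /eqP; rewrite mulf_eq0 => /orP[/eqP|/eqP]; first lra.
by move=> e5; have e6 : q = s by [lra]; rewrite e6 in e2; lra.
Qed.

Variables (A : R -> R) (K N : nat).
Hypotheses (A_cont : continuous A) (A_ge0 : forall x, 0 <= A x).
Hypotheses (AD2pi : forall x, A (x + 2 * pi) = A x).
Hypotheses (A_level : level_count_le K A) (N_gt0 : (0 < N)%N).

Definition equispaced_mean (n : nat) (g : R -> R) x :=
  n%:R^-1 * \sum_(m < n) g (x + m%:R * (2 * pi / n%:R)).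

Lemma continuous_sqrtD (g : R -> R) (b : R) : continuous g ->
  continuous (fun x => Num.sqrt (g x + b)).
Proof.
move=> cg x; apply: (cvg_comp (fun x => g x + b) Num.sqrt); last exact: sqrt_continuous.
by apply: cvgD; [exact: cg|exact: cvg_cst].
Qed.

(** The equispaced gap for the increment, divided by [N]. Negative terms are moved across so that
    both sides can be integrated as nonnegative functions. Exchanging [s] and [t] gives the opposite
    estimate. *)
Lemma equispaced_mean_sqrt_gap (kappa b y s t : R) :
  K%:R <= kappa * N%:R -> 0 <= b -> 0 <= y ->
  equispaced_mean N (fun x => Num.sqrt (A x + b + y)) s
    + equispaced_mean N (fun x => Num.sqrt (A x + y)) t + kappa * Num.sqrt y
  <= equispaced_mean N (fun x => Num.sqrt (A x + b + y)) t
    + equispaced_mean N (fun x => Num.sqrt (A x + y)) s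
    + kappa * Num.sqrt (b + y).
Proof.
(* For b = 0 the increment is identically zero, hence not injective, and the claim is an
   equality. *)
move=> Kk; rewrite le_eqVlt => /predU1P[<- y0|b0 y0].
  by rewrite add0r; under [X in equispaced_mean N X]eq_fun do rewrite addr0; lra.
pose psi a := Num.sqrt (a + b + y) - Num.sqrt (a + y).
pose M := Num.sqrt (b + y) - Num.sqrt y.
have b0' := ltW b0.
have psiM x : psi (A x) <= M by exact: sqrt_increment_le.
have M0 : 0 <= M by rewrite subr_ge0 ler_wsqrtr//; lra.
have psi0 x : 0 <= psi (A x).
  by rewrite subr_ge0 ler_wsqrtr//; have := A_ge0 x; lra.
have hK : level_count_le K (psi \o A).
  by apply: level_count_comp => // x x'; exact: sqrt_increment_inj.
have hc : continuous (psi \o A).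
  move=> x; apply: (@cvgB R R R); last exact: continuous_sqrtD.
  under eq_fun do rewrite -addrA; rewrite -addrA; exact: continuous_sqrtD.
have h2pi x : (psi \o A) (x + 2 * pi) = (psi \o A) x by rewrite /= AD2pi.
have := equispaced_sum_gap hc h2pi psi0 psiM hK N_gt0 s t.
rewrite /= /psi !sumrB => gap.
have N0 : 0 < N%:R :> R by rewrite ltr0n.
rewrite -(ler_pM2l N0) /equispaced_mean !(mulrDr N%:R) !mulVKf ?gt_eqF//.
have : K%:R * M <= kappa * N%:R * M by rewrite ler_wpM2r.
move: gap; rewrite /M; lra.
Qed.

End SqrtGap.

(** * The normalized measure on the torus and its translation invariance *)

Section TorusMeasure.
Variable R : realType.

Lemma twopi_gt0 : 0 < 2 * pi :> R.
Proof. by rewrite mulr_gt0// pi_gt0. Qed.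

(** [muT] as a probability measure on the line, so that product measures and Tonelli's theorem
    apply. *)
Definition torus_prob : probability (measurableTypeR R) R :=
  uniform_prob twopi_gt0.

Lemma torus_probE (A : set (measurableTypeR R)) :
  measurable A -> torus_prob A = muT A.
Proof.
move=> mA; rewrite /torus_prob/= /uniform_prob integral_uniform_pdf /muT /I2pi.
rewrite (eq_integral (fun=> ((2 * pi)^-1)%:E)); last first.
  move=> x /set_mem[_]/=; rewrite in_itv/= => xI.
  by rewrite /uniform_pdf xI subr0.
by rewrite integral_cst//; exact: measurableI.
Qed.

Lemma integral_torus (f : measurableTypeR R -> \bar R) :
  measurable_fun setT f -> (forall x, 0 <= f x)%E ->
  (\int[torus_prob]_x f x
    = ((2 * pi)^-1)%:E * \int[lebesgue_measure]_(x in @I2pi R) f x)%E.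
Proof. by move=> mf f0; rewrite /torus_prob/= integral_uniform// subr0. Qed.

Lemma measurable_shift (c : R) :
  measurable_fun setT ((fun x => x + c) : measurableTypeR R -> measurableTypeR R).
Proof. by apply: measurable_funD => //; exact: measurable_cst. Qed.

(** By uniqueness of Lebesgue measure it suffices to compare half-open intervals. *)
Lemma lebesgue_measure_shift (c : R) (A : set (measurableTypeR R)) :
  measurable A -> pushforward lebesgue_measure
    ((fun x => x + c) : measurableTypeR R -> measurableTypeR R) A
  = lebesgue_measure A.
Proof.
move=> mA; pose f : {mfun measurableTypeR R >-> measurableTypeR R} :=
  HB.pack ((fun x => x + c) : measurableTypeR R -> measurableTypeR R)
    (isMeasurableFun.Build _ _ _ _ _ (measurable_shift c)).
apply/esym; apply: (@lebesgue_measure_unique R (pushforward lebesgue_measure f)) => //.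
move=> _ [[a b]] _ <-; rewrite /pushforward.
transitivity (lebesgue_measure (`]a - c, b - c]%classic : set (measurableTypeR R))).
  rewrite !lebesgue_measure_itv/= !lte_fin ltrD2r.
  by case: ifP => // _; rewrite -!EFinB; congr EFin; ring.
congr lebesgue_measure.
by apply/seteqP; split => x /=; rewrite !in_itv/= ltrBlDr lerBrDr.
Qed.

Lemma integral_itv_shift (f : measurableTypeR R -> \bar R) (a b c : R) :
  measurable_fun setT f -> (forall x, 0 <= f x)%E ->
  (\int[lebesgue_measure]_(x in `[a, b[) f (x + c)%R
    = \int[lebesgue_measure]_(x in `[(a + c)%R, (b + c)%R[) f x)%E.
Proof.
move=> mf f0.
pose g : measurableTypeR R -> measurableTypeR R := fun x => x + c.
have -> : `[a, b[%classic = g @^-1` `[a + c, b + c[%classic.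
  by apply/seteqP; split => x /=; rewrite !in_itv/= lerD2r ltrD2r.
rewrite -[LHS]/(\int[lebesgue_measure]_(x in g @^-1` `[(a + c)%R, (b + c)%R[) (f \o g) x)%E.
rewrite -(ge0_integral_pushforward (measurable_shift c))//; last first.
  exact: measurable_funS mf.
apply: eq_measure_integral => [|mg A mA _]; first exact: measurable_shift.
exact: lebesgue_measure_shift.
Qed.

(** The shifted integral runs over [c, 2 pi + c); periodicity carries its part beyond 2 pi back to
    [0, c). *)
Lemma integral_torus_shift (f : measurableTypeR R -> \bar R) (c : R) :
  measurable_fun setT f -> (forall x, 0 <= f x)%E ->
  (forall x, f (x + 2 * pi)%R = f x) -> 0 <= c <= 2 * pi ->
  (\int[torus_prob]_x f (x + c)%R = \int[torus_prob]_x f x)%E.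
Proof.
move=> mf f0 f2pi /andP[c0 c1].
have mfc : measurable_fun setT (fun x : measurableTypeR R => f (x + c)).
  by apply: (measurableT_comp mf); exact: measurable_shift.
have mS (D : set (measurableTypeR R)) : measurable_fun D f.
  exact: measurable_funTS.
rewrite !integral_torus//; congr (_ * _)%E; rewrite /I2pi.
(* Dropping the right endpoint changes no integral and makes adjacent intervals disjoint. *)
rewrite -!integral_itv_bndo_bndc; [|exact: mS|exact: measurable_funTS].
rewrite integral_itv_shift// add0r.
have splitI (a b e : R) : a <= b -> b <= e ->
    (\int[lebesgue_measure]_(x in `[a, e[) f x
     = \int[lebesgue_measure]_(x in `[a, b[) f x
       + \int[lebesgue_measure]_(x in `[b, e[) f x)%E.
  move=> ab be; rewrite -ge0_integral_setU//.
  - by rewrite -itv_bndbnd_setU// !bnd_simp.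
  - apply/disj_setPS => x [] /=; rewrite !in_itv/= => /andP[_ xb] /andP[bx _].
    by move: xb; rewrite ltNge bx.
rewrite (splitI c (2 * pi)); [|exact: c1|by rewrite lerDl].
rewrite [RHS](splitI 0 c)// addeC; congr (_ + _)%E.
rewrite -[in LHS](add0r (2 * pi)) [X in `[_, X[](_ : _ = c + 2 * pi); last by ring.
by rewrite -integral_itv_shift//; under eq_integral do rewrite f2pi.
Qed.

End TorusMeasure.

(** * Decoupling a single function *)

Section OneStep.
Variable R : realType.
Local Notation U := (torus_prob R).

Lemma integral_prob_cst d (T : measurableType d) (P : probability T R) (c : R) :
  (\int[P]_x c%:E = c%:E)%E.
Proof. by rewrite integral_cst//= probability_setT mule1. Qed.

Lemma integral_prob_fin_num d (T : measurableType d) (P : probability T R)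
    (f : T -> R) (B : R) : measurable_fun setT f ->
  (forall x, 0 <= f x) -> (forall x, f x <= B) ->
  (\int[P]_x (f x)%:E)%E \is a fin_num.
Proof.
move=> mf f0 fB; rewrite ge0_fin_numE; last first.
  by apply: integral_ge0 => x _; rewrite lee_fin.
apply: (@le_lt_trans _ _ (\int[P]_x B%:E)%E); last first.
  by rewrite integral_prob_cst ltry.
apply: ge0_le_integral => //.
- by move=> x _; rewrite lee_fin.
- exact/measurable_EFinP.
- by move=> x _; rewrite lee_fin.
Qed.

(** Serves to integrate in t an inequality in which s is frozen; constants survive because [U] has
    mass 1. *)
Lemma le_integral_cstD (c c' : R) (f g : R -> R) : 0 <= c -> 0 <= c' ->
  measurable_fun setT (f : measurableTypeR R -> measurableTypeR R) ->
  measurable_fun setT (g : measurableTypeR R -> measurableTypeR R) ->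
  (forall x, 0 <= f x) -> (forall x, 0 <= g x) ->
  (forall x, c + f x <= c' + g x) ->
  (c%:E + \int[U]_x (f x)%:E <= c'%:E + \int[U]_x (g x)%:E)%E.
Proof.
move=> c0 c'0 mf mg f0 g0 fg.
have cD (a : R) (h : measurableTypeR R -> R) : 0 <= a -> measurable_fun setT h ->
    (forall x, 0 <= h x) -> (a%:E + \int[U]_x (h x)%:E = \int[U]_x (a + h x)%:E)%E.
  move=> a0 mh h0; rewrite -(integral_prob_cst U a) -ge0_integralD//.
  - by move=> x _; rewrite lee_fin.
  - exact/measurable_EFinP.
rewrite !cD//; apply: ge0_le_integral => //.
- by move=> x _; rewrite lee_fin addr_ge0.
- by apply/measurable_EFinP; apply: measurable_funD.
- by apply/measurable_EFinP; apply: measurable_funD.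
- by move=> x _; rewrite lee_fin.
Qed.

Lemma continuous_equispaced_mean N (g : R -> R) :
  continuous g -> continuous (equispaced_mean N g).
Proof.
move=> cg x; apply: cvgMr; apply: cvg_big => [|m _]; first exact: add_continuous.
apply: (cvg_comp (fun x => x + _) g); last exact: cg.
by apply: cvgD; [exact: cvg_id|exact: cvg_cst].
Qed.

Lemma equispaced_mean_ge0 N (g : R -> R) x :
  (forall x, 0 <= g x) -> 0 <= equispaced_mean N g x.
Proof. by move=> g0; rewrite mulr_ge0 ?invr_ge0// sumr_ge0. Qed.

(** By translation invariance each of the [N] translates has the same integral as [g]. *)
Lemma integral_equispaced_mean N (g : R -> R) : (0 < N)%N -> continuous g ->
  (forall x, 0 <= g x) -> (forall x, g (x + 2 * pi) = g x) ->
  (\int[U]_x (equispaced_mean N g x)%:E = \int[U]_x (g x)%:E)%E.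
Proof.
move=> N0 cg g0 g2pi.
have mg : measurable_fun setT (g : measurableTypeR R -> measurableTypeR R).
  exact: continuous_measurable_fun.
have N0' : 0 < N%:R :> R by rewrite ltr0n.
under eq_integral do rewrite EFinM -sumEFin.
rewrite ge0_integralZl//; last 2 first.
- apply: emeasurable_sum => m; apply/measurable_EFinP.
  by apply: (measurableT_comp mg); exact: measurable_shift.
- by move=> x _; apply: sume_ge0 => m _; rewrite lee_fin.
rewrite ge0_integral_sum//; last 2 first.
- move=> m; apply/measurable_EFinP.
  by apply: (measurableT_comp mg); exact: measurable_shift.
- by move=> m x _; rewrite lee_fin.
rewrite (eq_bigr (fun=> \int[U]_x (g x)%:E)%E); last first.
  move=> m _; apply: (@integral_torus_shift R (fun x => (g x)%:E)) => //.
  - exact/measurable_EFinP.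
  - by move=> x; rewrite g2pi.
  - rewrite mulr_ge0 ?divr_ge0 ?(ltW (twopi_gt0 R))//=.
    rewrite mulrCA ler_piMr ?(ltW (twopi_gt0 R))// ler_pdivrMr// mul1r ler_nat.
    exact/ltnW/ltn_ord.
rewrite sumr_const card_ord -[X in (_ * X)%E]mule_natl muleA -EFinM mulVf ?mul1e//.
exact: lt0r_neq0.
Qed.

Variables (A X : R -> R) (K N : nat) (kappa B y : R).
Hypotheses (A_cont : continuous A) (A_ge0 : forall x, 0 <= A x).
Hypotheses (A_le : forall x, A x <= B).
Hypotheses (AD2pi : forall x, A (x + 2 * pi) = A x).
Hypotheses (A_level : level_count_le K A) (N_gt0 : (0 < N)%N).
Hypotheses (X_cont : continuous X) (X_ge0 : forall x, 0 <= X x).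
Hypothesis XD : forall x, X (x + 2 * pi / N%:R) = X x.
Hypotheses (K_le : K%:R <= kappa * N%:R) (y_ge0 : 0 <= y).

Let kappa_ge0 : 0 <= kappa.
Proof.
have N0 : 0 < N%:R :> R by rewrite ltr0n.
by rewrite -(pmulr_lge0 _ N0) (le_trans _ K_le).
Qed.

Let XDn (m : nat) x : X (x + m%:R * (2 * pi / N%:R)) = X x.
Proof.
elim: m => [|m IHm]; first by rewrite mul0r addr0.
by rewrite -natr1 mulrDl mul1r addrA XD.
Qed.

Let XD2pi x : X (x + 2 * pi) = X x.
Proof.
rewrite -[RHS](XDn N); congr (X (_ + _)).
by rewrite [RHS]mulrC divfK// pnatr_eq0 -lt0n.
Qed.

Let g b (x : R) := Num.sqrt (A x + b + y).
Let g0 (x : R) := Num.sqrt (A x + y).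
Let G (x : R) := Num.sqrt (A x + X x + y).
Let W (x : R) := Num.sqrt (X x + y).
Let Phi b := (\int[U]_t (g b t)%:E)%E.
Let I0 := (\int[U]_t (g0 t)%:E)%E.

Let cg b : continuous (g b).
Proof.
rewrite /g; under eq_fun do rewrite -addrA; exact: continuous_sqrtD.
Qed.
Let cg0 : continuous g0. Proof. exact: continuous_sqrtD. Qed.
Let cG : continuous G.
Proof.
apply: (@continuous_sqrtD _ (fun x => A x + X x)) => x.
by apply: cvgD; [exact: A_cont|exact: X_cont].
Qed.
Let cW : continuous W. Proof. exact: continuous_sqrtD. Qed.

(** The nodes based at [s] differ by multiples of 2 pi / N, a period of [X], so [X] takes the value
    [X s] at all of them and freezing b = X s loses nothing. *)
Let mean_gX s : equispaced_mean N (g (X s)) s = equispaced_mean N G s.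
Proof. by congr (_ * _); apply: eq_bigr => m _; rewrite /g /G XDn. Qed.

Let mcont (h : R -> R) : continuous h ->
  measurable_fun setT (h : measurableTypeR R -> measurableTypeR R).
Proof. exact: continuous_measurable_fun. Qed.

Let mPhiX : measurable_fun setT ((fun s => Phi (X s)) : measurableTypeR R -> \bar R).
Proof.
apply: (@measurable_fun_fubini_tonelli_F _ _ (measurableTypeR R)
  (measurableTypeR R) R U (fun st => (g (X st.1) st.2)%:E)) => [|st].
  apply/measurable_EFinP; rewrite /g.
  apply: (measurableT_comp (mcont (@sqrt_continuous R))).
  apply: measurable_funD => //; apply: measurable_funD.
    by apply: (measurableT_comp (mcont A_cont)).
  by apply: (measurableT_comp (mcont X_cont)).
by rewrite lee_fin sqrtr_ge0.
Qed.

Let I0_fin : I0 \is a fin_num.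
Proof.
apply: (@integral_prob_fin_num _ _ _ _ (Num.sqrt (B + y))).
- exact: mcont.
- by move=> x; rewrite sqrtr_ge0.
- by move=> x; rewrite ler_wsqrtr// lerD2r.
Qed.

Let integral_three (p q : R -> R) (F : measurableTypeR R -> \bar R) :
  continuous p -> continuous q -> (forall x, 0 <= p x) -> (forall x, 0 <= q x) ->
  measurable_fun setT F -> (forall x, 0 <= F x)%E ->
  (\int[U]_s ((p s + kappa * q s)%:E + F s)
    = \int[U]_s (p s)%:E + kappa%:E * \int[U]_s (q s)%:E + \int[U]_s F s)%E.
Proof.
move=> cp cq p0 q0 mF F0.
have mp := mcont cp; have mq := mcont cq.
rewrite ge0_integralD//; last 2 first.
- by move=> x _; rewrite lee_fin addr_ge0 ?mulr_ge0.
- apply/measurable_EFinP; apply: measurable_funD => //.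
  exact: measurable_funM.
under eq_integral do rewrite EFinD EFinM.
rewrite ge0_integralD//; last 4 first.
- by move=> x _; rewrite lee_fin.
- exact/measurable_EFinP.
- by move=> x _; rewrite lee_fin mulr_ge0.
- by apply/measurable_EFinP; exact: measurable_funM.
rewrite ge0_integralZl//; first exact/measurable_EFinP.
by move=> x _; rewrite lee_fin.
Qed.

Let cst_ge0 (h : R -> R) (s q : R) : (forall x, 0 <= h x) -> 0 <= q ->
  0 <= equispaced_mean N h s + kappa * q.
Proof.
by move=> h0 q0; apply: addr_ge0; [exact: equispaced_mean_ge0|exact: mulr_ge0].
Qed.

Let integral_mean_g0 : (\int[U]_t (equispaced_mean N g0 t)%:E = I0)%E.
Proof.
rewrite integral_equispaced_mean// => x; first exact: sqrtr_ge0.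
by rewrite /g0 AD2pi.
Qed.

Let integral_mean_g b : (\int[U]_t (equispaced_mean N (g b) t)%:E = Phi b)%E.
Proof.
rewrite integral_equispaced_mean// => x; first exact: sqrtr_ge0.
by rewrite /g AD2pi.
Qed.

Let integral_mean_G :
  (\int[U]_t (equispaced_mean N G t)%:E = \int[U]_t (G t)%:E)%E.
Proof.
rewrite integral_equispaced_mean// => x; first exact: sqrtr_ge0.
by rewrite /G AD2pi XD2pi.
Qed.

Let mmean (h : R -> R) : continuous h -> measurable_fun setT
  (equispaced_mean N h : measurableTypeR R -> measurableTypeR R).
Proof. by move=> ch; apply: mcont; exact: continuous_equispaced_mean. Qed.

Let mean_ge0 (h : R -> R) x : (forall x, 0 <= h x) -> 0 <= equispaced_mean N h x.
Proof. exact: equispaced_mean_ge0. Qed.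

Let Phi_ge0 b : (0 <= Phi b)%E.
Proof. by apply: integral_ge0 => t _; rewrite lee_fin sqrtr_ge0. Qed.

Let I0_ge0 : (0 <= I0)%E.
Proof. by apply: integral_ge0 => t _; rewrite lee_fin sqrtr_ge0. Qed.

Let g_ge0 b x : 0 <= g b x. Proof. exact: sqrtr_ge0. Qed.
Let g0_ge0 x : 0 <= g0 x. Proof. exact: sqrtr_ge0. Qed.
Let G_ge0 x : 0 <= G x. Proof. exact: sqrtr_ge0. Qed.
Let W_ge0 x : 0 <= W x. Proof. exact: sqrtr_ge0. Qed.

Let mint (p q : R -> R) (F : measurableTypeR R -> \bar R) :
  continuous p -> continuous q -> measurable_fun setT F -> measurable_fun setT
    ((fun s => (p s + kappa * q s)%:E + F s)%E : measurableTypeR R -> \bar R).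
Proof.
move=> cp cq mF; apply: emeasurable_funD => //; apply/measurable_EFinP.
by apply: measurable_funD; [exact: mcont|apply: measurable_funM => //; exact: mcont].
Qed.

(** Take b = X s in the gap inequality and integrate in t, then in s. The term [I0] then appears on
    both sides and cancels, being finite. *)
Lemma decoupling_step_upper :
  (\int[U]_s (Num.sqrt (A s + X s + y))%:E + kappa%:E * (Num.sqrt y)%:E
   <= \int[U]_s \int[U]_t (Num.sqrt (A t + X s + y))%:E
      + kappa%:E * \int[U]_s (Num.sqrt (X s + y))%:E)%E.
Proof.
have pointwise s : ((equispaced_mean N G s + kappa * Num.sqrt y)%:E + I0
    <= (equispaced_mean N g0 s + kappa * W s)%:E + Phi (X s))%E.
  rewrite -integral_mean_g0 -integral_mean_g.
  apply: le_integral_cstD; rewrite ?cst_ge0 ?sqrtr_ge0//; try exact: mmean.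
  - by move=> x; exact: mean_ge0.
  - by move=> x; exact: mean_ge0.
  - move=> t; have := equispaced_mean_sqrt_gap A_cont A_ge0 AD2pi A_level N_gt0
      s t K_le (X_ge0 s) y_ge0.
    by rewrite -/(g (X s)) -/g0 -/(W s) mean_gX; lra.
have : (\int[U]_s ((equispaced_mean N G s + kappa * Num.sqrt y)%:E + I0)
  <= \int[U]_s ((equispaced_mean N g0 s + kappa * W s)%:E + Phi (X s)))%E.
  apply: ge0_le_integral => //.
  - by move=> s _; rewrite adde_ge0 ?lee_fin ?cst_ge0 ?sqrtr_ge0.
  - apply: mint => //; first exact: continuous_equispaced_mean.
    by move=> x; exact: cvg_cst.
  - by apply: mint => //; exact: continuous_equispaced_mean.
rewrite !integral_three//; try exact: continuous_equispaced_mean;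
  try (by move=> x; exact: mean_ge0); last by move=> x; exact: cvg_cst.
rewrite integral_mean_g0 integral_mean_G integral_prob_cst.
have -> : (\int[U]_s I0 = I0)%E by rewrite -(fineK I0_fin) integral_prob_cst.
by rewrite -[X in (_ <= X)%E -> _]addeA [X in (_ <= X)%E -> _]addeC leeD2rE// => h;
  rewrite [leRHS]addeC.
Qed.

(** The same argument with s and t exchanged in the gap inequality. *)
Lemma decoupling_step_lower :
  (\int[U]_s \int[U]_t (Num.sqrt (A t + X s + y))%:E
      + kappa%:E * (Num.sqrt y)%:E
   <= \int[U]_s (Num.sqrt (A s + X s + y))%:E
      + kappa%:E * \int[U]_s (Num.sqrt (X s + y))%:E)%E.
Proof.
have pointwise s : ((equispaced_mean N g0 s + kappa * Num.sqrt y)%:E + Phi (X s)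
    <= (equispaced_mean N G s + kappa * W s)%:E + I0)%E.
  rewrite -integral_mean_g0 -integral_mean_g.
  apply: le_integral_cstD; rewrite ?cst_ge0 ?sqrtr_ge0//; try exact: mmean.
  - by move=> x; exact: mean_ge0.
  - by move=> x; exact: mean_ge0.
  - move=> t; have := equispaced_mean_sqrt_gap A_cont A_ge0 AD2pi A_level N_gt0
      t s K_le (X_ge0 s) y_ge0.
    by rewrite -/(g (X s)) -/g0 -/(W s) mean_gX; lra.
have : (\int[U]_s ((equispaced_mean N g0 s + kappa * Num.sqrt y)%:E + Phi (X s))
  <= \int[U]_s ((equispaced_mean N G s + kappa * W s)%:E + I0))%E.
  apply: ge0_le_integral => //.
  - by move=> s _; rewrite adde_ge0 ?lee_fin ?cst_ge0 ?sqrtr_ge0.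
  - apply: mint => //; first exact: continuous_equispaced_mean.
    by move=> x; exact: cvg_cst.
  - by apply: mint => //; exact: continuous_equispaced_mean.
rewrite !integral_three//; try exact: continuous_equispaced_mean;
  try (by move=> x; exact: mean_ge0); last by move=> x; exact: cvg_cst.
rewrite integral_mean_g0 integral_mean_G integral_prob_cst.
have -> : (\int[U]_s I0 = I0)%E by rewrite -(fineK I0_fin) integral_prob_cst.
by rewrite -[X in (X <= _)%E -> _]addeA [X in (X <= _)%E -> _]addeC leeD2rE// => h;
  rewrite [leLHS]addeC.
Qed.

End OneStep.

(** * Resampling one coordinate of the infinite product *)

Section InfiniteProduct.
Variable R : realType.
Local Notation U := (torus_prob R).
Local Notation T := (Tinf R).

Lemma measurable_coord k :
  measurable_fun setT ((fun t => t k) : T -> measurableTypeR R).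
Proof.
move=> _ A mA; rewrite setTI; apply: sub_sigma_algebra.
by exists k, A.
Qed.

Definition rectangle (n : nat) (A : nat -> set R) : set T :=
  [set t | forall k, (k < n)%N -> A k (t k)].

Definition rectangles : set (set T) := [set B | exists n A,
  (forall k, measurable (A k : set (measurableTypeR R))) /\ B = rectangle n A].

Lemma measurable_rectangle n A :
  (forall k, measurable (A k : set (measurableTypeR R))) ->
  measurable (rectangle n A).
Proof.
move=> mA; have -> : rectangle n A
    = \bigcap_(k in [set k | (k < n)%N]) ((fun t : T => t k) @^-1` A k).
  by apply/seteqP; split.
apply: bigcap_measurableType => k _.
by rewrite -[X in measurable X]setTI; exact: measurable_coord.
Qed.

Lemma setI_closed_rectangles : setI_closed rectangles.
Proof.
move=> _ _ [n [A [mA ->]]] [n' [A' [mA' ->]]].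
pose B k := (if (k < n)%N then A k else setT) `&` (if (k < n')%N then A' k else setT).
exists (maxn n n'), B; split => [k|].
  by apply: measurableI; case: ifP.
apply/seteqP; split => t /=.
  by move=> [tA tA'] k _; rewrite /B; split; case: ifP => // kn; [exact: tA|exact: tA'].
move=> tB; split => k kn.
  by have := tB k; rewrite leq_max kn => /(_ isT)[]; rewrite kn.
by have := tB k; rewrite leq_max kn orbT => /(_ isT)[_]; rewrite kn.
Qed.

(** Rectangles are closed under intersection and generate the sigma-algebra, so a finite measure is
    determined by its values on them. *)
Lemma measure_eq_on_rectangles (m1 m2 : {measure set T -> \bar R}) :
  (m1 setT < +oo)%E -> (forall B, rectangles B -> m1 B = m2 B) ->
  forall B, measurable B -> m1 B = m2 B.
Proof.
move=> m1T m12 B mB.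
have GT : rectangles setT by exists 0%N, (fun=> setT); split => //; apply/seteqP; split.
apply: (g_sigma_algebra_measure_unique rectangles _ (fun=> setT)) => //.
- by move=> _ [n [A [mA ->]]]; exact: measurable_rectangle.
- by rewrite bigcup_const.
- exact: setI_closed_rectangles.
- move: B mB; apply: smallest_sub; first exact: smallest_sigma_algebra.
  move=> _ [k [A [mA ->]]]; apply: sub_sigma_algebra.
  (* A cylinder over coordinate [k] is a rectangle of length k + 1 whose other sides are the whole
     line. *)
  exists k.+1, (fun j => if j == k then A else setT); split => [j|].
    by case: ifP.
  apply/seteqP; split => t /=.
    by move=> tA j _; case: eqP => // ->.
  by move=> /(_ k (ltnSn k)); rewrite eqxx.
Qed.

Definition resample (i : nat) (ts : T * measurableTypeR R) : T :=
  fun k => if k == i then ts.2 else ts.1 k.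

Lemma measurable_resample i : measurable_fun setT (resample i).
Proof.
apply: (@measurability _ _ (T * measurableTypeR R)%type T setT (resample i)
  (@cylinders R) erefl).
move=> _ [_ [k [A [mA ->]]] <-].
rewrite setTI; have [ki|ki] := eqVneq k i.
  rewrite (_ : _ @^-1` _ = snd @^-1` A); last first.
    by apply/seteqP; split => ts /=; rewrite /resample ki eqxx.
  by rewrite -[X in measurable X]setTI; exact: measurable_snd.
rewrite (_ : _ @^-1` _ = fst @^-1` ((fun t : T => t k) @^-1` A)); last first.
  by apply/seteqP; split => ts /=; rewrite /resample (negbTE ki).
rewrite -[X in measurable X]setTI; apply: measurable_fst => //.
by rewrite -[X in measurable X]setTI; exact: measurable_coord.
Qed.

Variable P : probability T R.
Hypothesis P_prod : is_infinite_product P.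

Let prob_rectangle n (A : nat -> set R) :
  (forall k, measurable (A k : set (measurableTypeR R))) ->
  P (rectangle n A) = (\prod_(k < n) muT (A k))%E.
Proof. exact: P_prod. Qed.

(** It suffices to test rectangles. The preimage of a rectangle is a product: the i-th side is freed
    in the first factor and imposed on the fresh variable. *)
Lemma pushforward_resample i (B : set T) : measurable B ->
  pushforward (P \x U)%E (resample i) B = P B.
Proof.
pose f : {mfun (T * measurableTypeR R)%type >-> T} :=
  HB.pack (resample i) (isMeasurableFun.Build _ _ _ _ _ (measurable_resample i)).
move=> mB; apply/esym.
apply: (@measure_eq_on_rectangles P (pushforward (P \x U)%E f)) => //.
  by rewrite /= probability_setT ltry.
move=> _ [n [A [mA ->]]]; rewrite [LHS]prob_rectangle// /pushforward.
pose A' k := if k == i then setT else A k.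
(* For i >= n the rectangle does not restrict coordinate [i]. *)
pose C := if (i < n)%N then A i else setT.
have mA' k : measurable (A' k : set (measurableTypeR R)) by rewrite /A'; case: ifP.
have mC : measurable (C : set (measurableTypeR R)) by rewrite /C; case: ifP.
have fE : f @^-1` rectangle n A = rectangle n A' `*` C.
  apply/seteqP; split => [[t s]|[t s] []] /=.
    move=> h; split => [k kn|].
      by have := h k kn; rewrite /A' /resample/=; case: ifP.
    by rewrite /C; case: ifP => // jn; have := h i jn; rewrite /resample/= eqxx.
  move=> h1 h2 k kn; rewrite /resample/=; case: eqP => [ki|/eqP ki].
    by move: h2; rewrite /C -ki kn.
  by have := h1 k kn; rewrite /A' (negbTE ki).
transitivity ((P \x U)%E (rectangle n A' `*` C)); last by rewrite -fE.
rewrite product_measure1E//; last exact: measurable_rectangle.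
have muTT : muT [set: R] = 1%E by rewrite -torus_probE// probability_setT.
rewrite [X in (X * _)%E]prob_rectangle// [X in (_ * X)%E]torus_probE//.
rewrite /C; case: (ltnP i n) => [jn|nj].
  rewrite (bigD1 (Ordinal jn))//= [in RHS](bigD1 (Ordinal jn))//=.
  rewrite {1}/A' eqxx muTT mul1e muleC; congr (_ * _)%E.
  by apply: eq_bigr => k; rewrite /A' -val_eqE /= => /negbTE ->.
rewrite muTT mule1; apply: eq_bigr => k _; rewrite /A' ifF//.
by apply/negbTE; rewrite neq_ltn (leq_trans (ltn_ord k) nj).
Qed.

(** Tonelli's theorem in coordinate [i] without splitting the infinite product: the coordinate is
    overwritten by an independent variable. *)
Lemma integral_resample i (G : T -> \bar R) :
  measurable_fun setT G -> (forall t, 0 <= G t)%E ->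
  (\int[P]_t G t = \int[P]_t \int[U]_s G (resample i (t, s)))%E.
Proof.
move=> mG G0.
have mGi : measurable_fun setT (G \o resample i).
  by apply: measurableT_comp => //; exact: measurable_resample.
transitivity (\int[P \x U]_z (G \o resample i) z)%E; last first.
  by rewrite fubini_tonelli1// => z; exact: G0.
rewrite -(@ge0_integral_pushforward _ _ _ _ R _ (measurable_resample i) _ setT)//.
apply/esym/eq_measure_integral => [|mf B mB _]; first exact: measurable_resample.
exact: pushforward_resample.
Qed.

End InfiniteProduct.

(** * Hybrid norms and telescoping for finitely many functions *)

Section Telescoping.
Variable R : realType.
Local Notation U := (torus_prob R).
Local Notation T := (Tinf R).
Variables (P : probability T R) (X : nat -> R -> R) (N : nat -> nat) (kappa : R).
Hypothesis P_prod : is_infinite_product P.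
Hypotheses (X_cont : forall k, continuous (X k)) (X_ge0 : forall k x, 0 <= X k x).
Hypothesis X_bound : forall k, exists B, forall x, X k x <= B.
Hypothesis N_gt0 : forall k, (0 < N k)%N.
Hypothesis XD : forall k x, X k (x + 2 * pi / (N k)%:R) = X k x.
Variable n : nat.
Hypothesis X_level : forall i, (i < n)%N -> exists2 K,
  level_count_le K (fun x => \sum_(k < i) X k x) & K%:R <= kappa * (N i)%:R.

Let XD2pi k x : X k (x + 2 * pi) = X k x.
Proof.
have XDn (m : nat) : X k (x + m%:R * (2 * pi / (N k)%:R)) = X k x.
  elim: m => [|m IHm]; first by rewrite mul0r addr0.
  by rewrite -natr1 mulrDl mul1r addrA XD.
rewrite -[RHS](XDn (N k)); congr (X k (_ + _)).
by rewrite [RHS]mulrC divfK// pnatr_eq0 -lt0n.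
Qed.

Let head i (x : R) := \sum_(k < i) X k x.
Let tail i (t : T) := \sum_(i <= k < n) X k (t k).

Let head_cont i : continuous (head i).
Proof.
move=> x; apply: cvg_big => [|k _]; first exact: add_continuous.
exact: X_cont.
Qed.
Let head_ge0 i x : 0 <= head i x. Proof. exact: sumr_ge0. Qed.
Let tail_ge0 i t : 0 <= tail i t. Proof. exact: sumr_ge0. Qed.
Let headD2pi i x : head i (x + 2 * pi) = head i x.
Proof. by apply: eq_bigr => k _; rewrite XD2pi. Qed.

Let head_bound i : exists B, forall x, head i x <= B.
Proof.
have /choice[B XB] := X_bound.
by exists (\sum_(k < i) B k) => x; apply: ler_sum => k _.
Qed.

Let tail_bound i : exists B, forall t, tail i t <= B.
Proof.
have /choice[B XB] := X_bound.
by exists (\sum_(i <= k < n) B k) => t; apply: ler_sum => k _.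
Qed.

Let mcont (h : R -> R) : continuous h ->
  measurable_fun setT (h : measurableTypeR R -> measurableTypeR R).
Proof. exact: continuous_measurable_fun. Qed.

Let mtail i : measurable_fun setT (tail i : T -> measurableTypeR R).
Proof.
apply: measurable_sum => k; apply: (measurableT_comp (mcont (@X_cont k))).
exact: measurable_coord.
Qed.

(** Hybrid integrand: the first [i] functions share the point [x], the others keep their own
    coordinates. Its integral [J i] runs from the independent norm at i = 0 to the joint norm at i =
    n, while the integral [W i] of [b i] accounts for the error. *)
Let a i t := (\int[U]_x (Num.sqrt (head i x + tail i t))%:E)%E.
Let b i t := (Num.sqrt (tail i t))%:E.

Let a_ge0 i t : (0 <= a i t)%E.
Proof. by apply: integral_ge0 => x _; rewrite lee_fin sqrtr_ge0. Qed.

Let b_ge0 i t : (0 <= b i t)%E. Proof. by rewrite lee_fin sqrtr_ge0. Qed.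

Let ma i : measurable_fun setT (a i).
Proof.
apply: (@measurable_fun_fubini_tonelli_F _ _ T
  (measurableTypeR R) R U (fun tx => (Num.sqrt (head i tx.2 + tail i tx.1))%:E))
  => [|tx]; last by rewrite lee_fin sqrtr_ge0.
apply/measurable_EFinP; apply: (measurableT_comp (mcont (@sqrt_continuous R))).
apply: measurable_funD.
  by apply: (measurableT_comp (mcont (@head_cont i))).
by apply: (measurableT_comp (@mtail i)).
Qed.

Let mb i : measurable_fun setT (b i).
Proof.
apply/measurable_EFinP; apply: (measurableT_comp (mcont (@sqrt_continuous R))).
exact: mtail.
Qed.

Let avg i (G : T -> \bar R) t := (\int[U]_s G (resample i (t, s)))%E.

Let avg_ge0 i G t : (forall t, 0 <= G t)%E -> (0 <= avg i G t)%E.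
Proof. by move=> G0; apply: integral_ge0 => s _. Qed.

Let mavg i (G : T -> \bar R) : measurable_fun setT G -> (forall t, 0 <= G t)%E ->
  measurable_fun setT (avg i G).
Proof.
move=> mG G0; apply: (@measurable_fun_fubini_tonelli_F _ _ T (measurableTypeR R)
  R U (fun ts => G (resample i ts))) => //.
by apply: measurableT_comp => //; exact: measurable_resample.
Qed.

Let tail_resample i t s : (i < n)%N ->
  tail i (resample i (t, s)) = X i s + tail i.+1 t.
Proof.
move=> ilt; rewrite /tail big_ltn// {1}/resample eqxx; congr (_ + _).
apply: eq_big_nat => k /andP[ik _]; congr (X k _).
by rewrite /resample gtn_eqF.
Qed.

Let headS i x : head i.+1 x = head i x + X i x.
Proof. by rewrite /head big_ord_recr. Qed.

Let J i := (\int[P]_t a i t)%E.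
Let W i := (\int[P]_t b i t)%E.

Hypothesis kappa_ge0 : 0 <= kappa.

Let integral_pair (F G : T -> \bar R) :
  measurable_fun setT F -> measurable_fun setT G ->
  (forall t, 0 <= F t)%E -> (forall t, 0 <= G t)%E ->
  (\int[P]_t (F t + kappa%:E * G t) = \int[P]_t F t + kappa%:E * \int[P]_t G t)%E.
Proof.
move=> mF mG F0 G0; rewrite ge0_integralD//.
- by rewrite ge0_integralZl.
- by move=> t _; rewrite mule_ge0.
- exact: measurable_funeM.
Qed.

Let le_integral_pair (F G F' G' : T -> \bar R) :
  measurable_fun setT F -> measurable_fun setT G ->
  measurable_fun setT F' -> measurable_fun setT G' ->
  (forall t, 0 <= F t)%E -> (forall t, 0 <= G t)%E ->
  (forall t, 0 <= F' t)%E -> (forall t, 0 <= G' t)%E ->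
  (forall t, F t + kappa%:E * G t <= F' t + kappa%:E * G' t)%E ->
  (\int[P]_t F t + kappa%:E * \int[P]_t G t
    <= \int[P]_t F' t + kappa%:E * \int[P]_t G' t)%E.
Proof.
move=> mF mG mF' mG' F0 G0 F'0 G'0 FG; rewrite -!integral_pair//.
apply: ge0_le_integral => //.
- by move=> t _; rewrite adde_ge0// mule_ge0.
- by apply: emeasurable_funD => //; exact: measurable_funeM.
- by apply: emeasurable_funD => //; exact: measurable_funeM.
Qed.

Let aS i t : (i < n)%N ->
  a i.+1 t = (\int[U]_s (Num.sqrt (head i s + X i s + tail i.+1 t))%:E)%E.
Proof. by move=> ilt; apply: eq_integral => s _; rewrite headS. Qed.

Let avg_a i t : (i < n)%N -> avg i (a i) t =
  (\int[U]_s \int[U]_x (Num.sqrt (head i x + X i s + tail i.+1 t))%:E)%E.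
Proof.
move=> ilt; apply: eq_integral => s _; apply: eq_integral => x _.
by rewrite tail_resample// addrA.
Qed.

Let avg_b i t : (i < n)%N -> avg i (b i) t =
  (\int[U]_s (Num.sqrt (X i s + tail i.+1 t))%:E)%E.
Proof. by move=> ilt; apply: eq_integral => s _; rewrite /b tail_resample. Qed.

(** Coordinate [i] is resampled only in [J i] and [W i], since [J i.+1] and [W i.+1] involve later
    coordinates alone. For fixed t this is the one-step bound with y equal to [tail i.+1 t]. *)
Let step_upper i : (i < n)%N ->
  (J i.+1 + kappa%:E * W i.+1 <= J i + kappa%:E * W i)%E.
Proof.
move=> ilt; have [K hK KN] := X_level ilt; have [B hB] := head_bound i.
rewrite /J /W (integral_resample P_prod i (@ma i))//.
rewrite [in leRHS](integral_resample P_prod i (@mb i))//.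
apply: le_integral_pair => //; rewrite -?/(avg i _);
  try exact: mavg; try (by move=> t; exact: avg_ge0).
move=> t; rewrite -/(avg i (a i) t) -/(avg i (b i) t) aS// avg_a// avg_b//.
exact: (decoupling_step_upper (@head_cont i) (@head_ge0 i) hB (@headD2pi i) hK
  (N_gt0 i) (@X_cont i) (X_ge0 i) (XD i) KN).
Qed.

Let step_lower i : (i < n)%N ->
  (J i + kappa%:E * W i.+1 <= J i.+1 + kappa%:E * W i)%E.
Proof.
move=> ilt; have [K hK KN] := X_level ilt; have [B hB] := head_bound i.
rewrite /J /W (integral_resample P_prod i (@ma i))//.
rewrite [in leRHS](integral_resample P_prod i (@mb i))//.
apply: le_integral_pair => //; rewrite -?/(avg i _);
  try exact: mavg; try (by move=> t; exact: avg_ge0).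
move=> t; rewrite -/(avg i (a i) t) -/(avg i (b i) t) aS// avg_a// avg_b//.
exact: (decoupling_step_lower (@head_cont i) (@head_ge0 i) hB (@headD2pi i) hK
  (N_gt0 i) (@X_cont i) (X_ge0 i) (XD i) KN).
Qed.

Let W_fin i : W i \is a fin_num.
Proof.
have [B hB] := tail_bound i.
apply: (integral_prob_fin_num P (f := fun t => Num.sqrt (tail i t))
  (B := Num.sqrt B)).
- by apply/measurable_EFinP; exact: mb.
- by move=> x; rewrite sqrtr_ge0.
- by move=> x; rewrite ler_wsqrtr.
Qed.

Let upper i : (i <= n)%N -> (J i + kappa%:E * W i <= J 0 + kappa%:E * W 0)%E.
Proof.
by elim: i => // i IHi ilt; rewrite (le_trans (step_upper ilt))// IHi// ltnW.
Qed.

(** In substance, J i - kappa W i does not decrease with [i]; the form chosen avoids subtraction. *)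
Let lower i : (i <= n)%N -> (J 0 + kappa%:E * W i <= J i + kappa%:E * W 0)%E.
Proof.
elim: i => // i IHi ilt.
have kW : (kappa%:E * W i)%E \is a fin_num by rewrite fin_numM.
(* Adding the finite term kappa W i to both sides lets the induction hypothesis and the step be
   chained. *)
rewrite -(leeD2rE _ _ kW) addeAC [leRHS]addeAC.
apply: (@le_trans _ _ (J i + kappa%:E * W 0 + kappa%:E * W i.+1)%E).
  by apply: leeD2r; exact/IHi/ltnW.
by rewrite addeAC; apply: leeD2r; exact: step_lower.
Qed.

Let J0 : J 0 = (\int[P]_t (Num.sqrt (\sum_(k < n) X k (t k)))%:E)%E.
Proof.
apply: eq_integral => t _; rewrite /a /head /tail big_mkord.
under eq_integral do rewrite big_ord0 add0r.
exact: integral_prob_cst.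
Qed.

Let W0 : W 0 = (\int[P]_t (Num.sqrt (\sum_(k < n) X k (t k)))%:E)%E.
Proof. by apply: eq_integral => t _; rewrite /b /tail big_mkord. Qed.

(** The tail is now empty, so the accumulated error is [kappa] times [W 0], which is the independent
    norm. *)
Let Wn : W n = 0%E.
Proof.
rewrite /W; under eq_integral do rewrite /b /tail big_geq// sqrtr0.
by rewrite integral0.
Qed.

Let Jn : J n = (\int[U]_x (Num.sqrt (\sum_(k < n) X k x))%:E)%E.
Proof.
rewrite /J /a; under eq_integral do
  under eq_integral do rewrite /tail big_geq// addr0.
by rewrite integral_cst//= probability_setT mule1.
Qed.

Lemma decoupling_upper :
  (\int[U]_x (Num.sqrt (\sum_(k < n) X k x))%:E
   <= (1%E + kappa%:E) * \int[P]_t (Num.sqrt (\sum_(k < n) X k (t k)))%:E)%E.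
Proof.
have := upper (leqnn n); rewrite Wn mule0 adde0 J0 W0 Jn.
by rewrite ge0_muleDl ?lee_fin// mul1e.
Qed.

Lemma decoupling_lower :
  ((1%E - kappa%:E) * \int[P]_t (Num.sqrt (\sum_(k < n) X k (t k)))%:E
   <= \int[U]_x (Num.sqrt (\sum_(k < n) X k x))%:E)%E.
Proof.
have := lower (leqnn n); rewrite Wn mule0 adde0 J0 -W0 Jn.
have := W_fin 0; case: (W 0) => // w _ h.
rewrite -EFinB -EFinM mulrBl mul1r EFinB leeBlDr//.
Qed.

End Telescoping.

(** * Passage from finite sums to the whole sequence *)

Section Truncation.
Variable R : realType.

Lemma l2_at_cvg (g : nat -> R[i]) :
  (Num.sqrt (\sum_(k < n) sqmod (g k)))%:E @[n --> \oo] --> l2_at g.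
Proof.
rewrite /l2_at; set S := (\sum_(0 <= k <oo) _)%E.
have S0 : (0 <= S)%E by apply: nneseries_ge0 => k _ _; rewrite lee_fin sqmod_ge0.
have uS : (\sum_(k < n) sqmod (g k))%:E @[n --> \oo] --> S.
  have -> : (fun n => (\sum_(k < n) sqmod (g k))%:E)
      = (fun n => \sum_(0 <= k < n) (sqmod (g k))%:E)%E.
    by apply/funext => n; rewrite big_mkord sumEFin.
  apply: is_cvg_nneseries => k _ _; by rewrite lee_fin sqmod_ge0.
move: S S0 uS => [s| |] //= _ uS.
  apply/cvg_EFin; first by near=> n.
  apply: (cvg_comp (fun n => \sum_(k < n) sqmod (g k)) Num.sqrt).
    exact: (fine_cvg uS).
  exact: sqrt_continuous.
(* When the series diverges, the roots reach [B] once the partial sums reach its square. *)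
apply/cvgeryP; apply/cvgryPge => B; have /cvgeryP/cvgryPge := uS.
move=> /(_ (B ^+ 2)); apply: filterS => n uB.
rewrite (le_trans (ler_norm B))// -sqrtr_sqr ler_wsqrtr//.
Unshelve. all: by end_near. Qed.

Lemma measurable_sqrt_sum d (T : measurableType d) (D : set T) (h : nat -> T -> R) n :
  (forall k, measurable_fun D (h k)) ->
  measurable_fun D (fun x => (Num.sqrt (\sum_(k < n) h k x))%:E).
Proof.
move=> mh; apply/measurable_EFinP.
apply: (measurableT_comp (continuous_measurable_fun (@sqrt_continuous R))).
exact: measurable_sum.
Qed.

Lemma sqrt_sum_homo (u : nat -> R) m n : (forall k, 0 <= u k) -> (m <= n)%N ->
  Num.sqrt (\sum_(k < m) u k) <= Num.sqrt (\sum_(k < n) u k).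
Proof.
move=> u0 mn; rewrite ler_wsqrtr// -!(big_mkord xpredT u) (big_cat_nat _ mn)//=.
by rewrite lerDl sumr_ge0.
Qed.

(** The truncated square functions increase to the full one, so monotone convergence applies. *)
Lemma integral_l2_at_cvg d (T : measurableType d) (mu : {measure set T -> \bar R})
    (D : set T) (h : nat -> T -> R[i]) : measurable D ->
  (forall k, measurable_fun D (fun x => sqmod (h k x))) ->
  (\int[mu]_(x in D) (Num.sqrt (\sum_(k < n) sqmod (h k x)))%:E)%E @[n --> \oo]
    --> (\int[mu]_(x in D) l2_at (fun k => h k x))%E.
Proof.
move=> mD mh.
pose u n x := (Num.sqrt (\sum_(k < n) sqmod (h k x)))%:E.
have -> : (\int[mu]_(x in D) l2_at (fun k => h k x)
    = \int[mu]_(x in D) limn (u ^~ x))%E.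
  by apply: eq_integral => x _; apply/esym/cvg_lim => //; exact: l2_at_cvg.
apply: cvg_monotone_convergence => //.
- by move=> n; apply: (@measurable_sqrt_sum _ _ _ (fun k x => sqmod (h k x))).
- move=> x _ m n mn; rewrite lee_fin.
  by apply: (@sqrt_sum_homo (fun k => sqmod (h k x))) => // k; exact: sqmod_ge0.
Qed.

End Truncation.

(** * Bounds for the full sequence, with finite and with infinite theta *)

Section Main.
Variable R : realType.
Local Notation U := (torus_prob R).
Variables (N d : nat -> nat) (f : nat -> R -> R[i]) (P : probability (Tinf R) R).
Hypothesis N_gt0 : forall k, (0 < N k)%N.
Hypothesis N_dvd : forall k, (N k %| N k.+1)%N.
Hypothesis f_deg : forall k, trig_poly_deg_le (d k) (f k).
Hypothesis f_per : forall k t, f k (t + 2 * pi / (N k)%:R) = f k t.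
Hypothesis P_prod : is_infinite_product P.

Let L n := (\int[U]_x (Num.sqrt (\sum_(k < n) sqmod (f k x)))%:E)%E.
Let E n := (\int[P]_t (Num.sqrt (\sum_(k < n) sqmod (f k (t k))))%:E)%E.

Let N_homo : {homo N : m n / (m <= n)%N}.
Proof.
by apply: homo_leq => // [k m n|k]; [exact: leq_trans|exact: dvdn_leq].
Qed.

(** The level count is four times the largest d_k with k < i, and d_k <= theta N_(k+1) <= theta N_i
    because k + 1 <= i and [N] is nondecreasing. *)
Let level (theta : R) n : (forall k, (k < n)%N -> (d k)%:R <= theta * (N k.+1)%:R) ->
  0 <= theta -> forall i, (i < n)%N -> exists2 K,
    level_count_le K (fun x => \sum_(k < i) sqmod (f k x)) &
    K%:R <= 4 * theta * (N i)%:R.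
Proof.
move=> dN th0 i ilt; pose D := (\max_(k < i) d k)%N.
exists (4 * D)%N.
  apply: (@level_count_sum_sqmod R f d) => // k ki.
  exact: (@leq_bigmax _ (fun k : 'I_i => d k) (Ordinal ki)).
rewrite natrM -mulrA ler_pM2l//; apply: (big_ind (fun m => m%:R <= theta * (N i)%:R)).
- by rewrite mulr_ge0.
- by move=> m m' hm hm'; case: (leqP m m') => _.
- move=> k _; rewrite (le_trans (dN k (ltn_trans (ltn_ord k) ilt)))//.
  by rewrite ler_wpM2l// ler_nat N_homo.
Qed.

(** Only the first [n] ratios enter, so this also serves when the supremum over all k is
    infinite. *)
Let truncated_bounds (theta : R) n : 0 <= theta ->
  (forall k, (k < n)%N -> (d k)%:R <= theta * (N k.+1)%:R) ->
  ((1%E - (4 * theta)%:E) * E n <= L n)%E /\ (L n <= (1%E + (4 * theta)%:E) * E n)%E.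
Proof.
move=> th0 dN; pose X k x := sqmod (f k x).
have Xc k : continuous (X k) by exact: continuous_sqmod_trig_poly (f_deg k).
have X0 k x : 0 <= X k x by exact: sqmod_ge0.
have XB k : exists B, forall x, X k x <= B by exact: bounded_sqmod_trig_poly (f_deg k).
have XD k x : X k (x + 2 * pi / (N k)%:R) = X k x by rewrite /X f_per.
have k0 : 0 <= 4 * theta by rewrite mulr_ge0.
split.
- exact: (decoupling_lower P_prod Xc X0 XB N_gt0 XD (level dN th0) k0).
- exact: (decoupling_upper P_prod Xc X0 XB N_gt0 XD (level dN th0) k0).
Qed.

Let L_cvg : L n @[n --> \oo] --> L1l2_norm f.
Proof.
have mf k : measurable_fun setT
    ((fun x => sqmod (f k x)) : measurableTypeR R -> measurableTypeR R).
  by apply: continuous_measurable_fun; exact: continuous_sqmod_trig_poly (f_deg k).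
have -> : L = (fun n => ((2 * pi)^-1)%:E * \int[lebesgue_measure]_(x in @I2pi R)
    (Num.sqrt (\sum_(k < n) sqmod (f k x)))%:E)%E.
  apply/funext => n; apply: integral_torus => [|x]; last by rewrite lee_fin sqrtr_ge0.
  exact: (@measurable_sqrt_sum _ _ _ _ (fun k x => sqmod (f k x))).
apply: cvgeZl => //; apply: integral_l2_at_cvg => [|k].
  exact: measurable_itv.
apply: measurable_funTS; exact: mf.
Qed.

Let mf_coord k : measurable_fun setT (fun t : Tinf R => sqmod (f k (t k))).
Proof.
have mf : measurable_fun setT
    ((fun x => sqmod (f k x)) : measurableTypeR R -> measurableTypeR R).
  by apply: continuous_measurable_fun; exact: continuous_sqmod_trig_poly (f_deg k).
by apply: (measurableT_comp mf); exact: measurable_coord.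
Qed.

Let E_cvg : E n @[n --> \oo] --> ind_norm P f.
Proof. exact: (@integral_l2_at_cvg _ _ _ P setT (fun k t => f k (t k))). Qed.

Let L_ge0 : (0 <= L1l2_norm f)%E.
Proof.
apply: (cvge_to_ge L_cvg); apply: nearW => n.
by apply: integral_ge0 => x _; rewrite lee_fin sqrtr_ge0.
Qed.

Let E_ge0 n : (0 <= E n)%E.
Proof. by apply: integral_ge0 => x _; rewrite lee_fin sqrtr_ge0. Qed.

Let E_le n : (E n <= ind_norm P f)%E.
Proof.
apply: (cvge_to_ge E_cvg); near=> m.
have nm : (n <= m)%N by near: m; exact: nbhs_infty_ge.
apply: ge0_le_integral => //.
- exact: (measurable_sqrt_sum (h := fun k (t : Tinf R) => sqmod (f k (t k)))).
- exact: (measurable_sqrt_sum (h := fun k (t : Tinf R) => sqmod (f k (t k)))).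
- move=> t _; rewrite lee_fin.
  by apply: (@sqrt_sum_homo R (fun k => sqmod (f k (t k)))) => // k; exact: sqmod_ge0.
Unshelve. all: by end_near. Qed.

Lemma decoupling_finite (theta : R) :
  (forall k, (d k)%:R / (N k.+1)%:R <= theta) ->
  ((1%E - 4%:E * theta%:E) * ind_norm P f <= L1l2_norm f)%E /\
  (L1l2_norm f <= (1%E + 4%:E * theta%:E) * ind_norm P f)%E.
Proof.
move=> dN; rewrite -EFinM.
have th0 : 0 <= theta by rewrite (le_trans _ (dN 0%N))// divr_ge0.
have h n := @truncated_bounds theta n th0.
have dN' k : (d k)%:R <= theta * (N k.+1)%:R.
  by rewrite -ler_pdivrMr// ltr0n.
split.
- apply: (lee_cvg_to (cvgeZl _ E_cvg) L_cvg); first by [].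
  by apply: nearW => n; have [] := h n (fun k _ => dN' k).
- apply: (lee_cvg_to L_cvg (cvgeZl _ E_cvg)); first by [].
  by apply: nearW => n; have [] := h n (fun k _ => dN' k).
Qed.

(** The lower bound has a nonpositive left side. The upper bound has +oo on the right unless the
    independent norm is 0; then the product is 0 by convention, and the joint norm must be shown to
    vanish. *)
Lemma decoupling_infinite :
  ((1%E - +oo) * ind_norm P f <= L1l2_norm f)%E /\
  (L1l2_norm f <= (1%E + +oo) * ind_norm P f)%E.
Proof.
have ind0 : (0 <= ind_norm P f)%E := le_trans (E_ge0 0) (E_le 0).
split.
  by apply: (le_trans _ L_ge0); apply: mule_le0_ge0 => //; rewrite /= leNye.
have := ind0; rewrite le_eqVlt => /predU1P[ind_eq0|]; last first.
  by move=> ind_gt0; rewrite /= gt0_mulye// leey.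
rewrite -ind_eq0 mule0; apply: (cvge_to_le L_cvg); apply: nearW => n.
(* Any finite bound on the first [n] ratios works, as it gets multiplied by [E n], which is 0. The
   sum of the [d k] is one, because each [N k.+1] is at least 1. *)
pose theta : R := \sum_(k < n) (d k)%:R.
have th0 : 0 <= theta by rewrite sumr_ge0.
have [|_] := @truncated_bounds theta n th0.
  move=> k kn; apply: (@le_trans _ _ theta).
    by rewrite /theta (bigD1 (Ordinal kn))//= lerDl sumr_ge0.
  by rewrite ler_peMr// ler1n.
suff -> : E n = 0%E by rewrite mule0.
by apply/eqP; rewrite eq_le E_ge0 andbT ind_eq0 E_le.
Qed.

End Main.

Unset Implicit Arguments.

(* Indices k = 0,1,2,... correspond to the paper's k = 1,2,3,... *)
Theorem theorem5p8 (R : realType) :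
  exists C : R, 0 < C /\
  forall (N d : nat -> nat) (f : nat -> R -> R[i])
         (P : probability (Tinf R) R),
    (forall k, (0 < N k)%N) ->
    (forall k, (N k %| N k.+1)%N) ->
    (forall k, (0 < d k)%N) ->
    (forall k, trig_poly_deg_le (d k) (f k)) ->
    (forall k t, f k (t + 2 * pi / (N k)%:R) = f k t) ->
    is_infinite_product P ->
    let theta : \bar R :=
      ereal_sup [set ((d k)%:R / (N k.+1)%:R)%:E | k in [set: nat]] in
    ((1%E - C%:E * theta) * ind_norm P f <= L1l2_norm f)%E /\
    (L1l2_norm f <= (1%E + C%:E * theta) * ind_norm P f)%E.
Proof.
(* The constant is the 4 of the level count 4D. *)
exists 4; split => // N d f P N0 Ndvd _ fd fper Pprod theta.
have le_theta k : (((d k)%:R / (N k.+1)%:R)%:E <= theta)%E.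
  by apply: ereal_sup_ubound; exists k.
case: theta le_theta => [r| |] le_theta.
- by apply: (decoupling_finite N0 Ndvd fd fper Pprod) => k; rewrite -lee_fin.
- by rewrite gt0_muley//; exact: (decoupling_infinite N0 Ndvd fd fper Pprod).
(* The value -oo is excluded, since theta is at least the real ratio at k = 0. *)
- by have := le_theta 0%N.
Qed.
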